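(* Monomorphisms in the category $\mathbf{Clus}$ of rooted cluster algebras and rooted cluster morphisms coincide with injective rooted cluster morphisms.
   Context: Countable means of cardinality at most $\aleph_0$; rings are unital and ring homomorphisms preserve identities. A seed is a triple $\Sigma=(\mathbf{x},\mathbf{ex},B)$ where $\mathbf{x}$ is a countable set of indeterminates over $\mathbb{Z}$ (the cluster), $\mathbf{ex}\subset\mathbf{x}$ is the set of exchangeable variables (those in $\mathbf{x}\setminus\mathbf{ex}$ are frozen), and $B=(b_{xy})_{x,y\in\mathbf{x}}$ is an integer matrix which is locally finite (each row and column has finite support) and skew-symmetrisable (there are positive integers $d_x$ with $d_xb_{xy}=-d_yb_{yx}$). Put $\mathcal{F}_\Sigma=\mathbb{Q}(x\mid x\in\mathbf{x})$. For $x\in\mathbf{ex}$ the mutation $\mu_x(\Sigma)=(\mathbf{x}',\mathbf{ex}',B')$ is obtained by replacing $x$ in $\mathbf{x}$ and in $\mathbf{ex}$ by $x'\in\mathcal{F}_\Sigma$ with $xx'=\prod_{b_{xy}>0}y^{b_{xy}}+\prod_{b_{xy}<0}y^{-b_{xy}}$, and (identifying the index $x'$ with $x$) $b'_{yz}=-b_{yz}$ if $x\in\{y,z\}$ and $b'_{yz}=b_{yz}+\frac12(|b_{yx}|b_{xz}+b_{yx}|b_{xz}|)$ otherwise. For $y\in\mathbf{x}$, $\mu_{x,\Sigma}(y)$ is the variable of $\mu_x(\Sigma)$ corresponding to $y$: it is $y$ if $y\ne x$ and $x'$ if $y=x$. A sequence $(x_1,\dots,x_l)$ is $\Sigma$-admissible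 if $x_1$ is exchangeable in $\Sigma$ and each $x_i$ ($i\ge2$) is exchangeable in $\mu_{x_{i-1}}\circ\cdots\circ\mu_{x_1}(\Sigma)$; $\mu_{x_l}\circ\cdots\circ\mu_{x_1,\Sigma}(y)$ denotes the variable corresponding to $y\in\mathbf{x}$ after these mutations. $\mathrm{Mut}(\Sigma)$ is the set of seeds obtained from $\Sigma$ by mutating along finite (possibly empty) admissible sequences. The rooted cluster algebra $\mathcal{A}(\Sigma)$ is the $\mathbb{Z}$-subalgebra of $\mathcal{F}_\Sigma$ generated by all variables in clusters of seeds in $\mathrm{Mut}(\Sigma)$, considered together with its initial seed $\Sigma$. For seeds $\Sigma=(\mathbf{x},\mathbf{ex},B)$, $\Sigma'=(\mathbf{x}',\mathbf{ex}',B')$ and a map $f:\mathcal{A}(\Sigma)\to\mathcal{A}(\Sigma')$, a sequence $(x_1,\dots,x_n)$ is $(f,\Sigma,\Sigma')$-biadmissible if it is $\Sigma$-admissible and $(f(x_1),\dots,f(x_n))$ is $\Sigma'$-admissible. A rooted cluster morphism $\mathcal{A}(\Sigma)\to\mathcal{A}(\Sigma')$ is a ring homomorphism $f$ such that (CM1) $f(\mathbf{x})\subset\mathbf{x}'\sqcup\mathbb{Z}$; (CM2) $f(\mathbf{ex})\subset\mathbf{ex}'\sqcup\mathbb{Z}$; (CM3) for every $(f,\Sigma,\Sigma')$-biadmissible sequence $(x_1,\dots,x_n)$ and every $y\in\mathbf{x}$, $f(\mu_{x_n}\circ\cdots\circ\mu_{x_1,\Sigma}(y))=\mu_{f(x_n)}\circ\cdots\circ\mu_{f(x_1),\Sigma'}(f(y))$,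 where mutations fix integers. $\mathbf{Clus}$ is the category whose objects are rooted cluster algebras and whose morphisms are rooted cluster morphisms. *)

(* Defs.v *)
From HB Require Import structures.
From mathcomp Require Import all_boot all_order all_algebra finmap monalg.
From mathcomp Require Import boolp classical_sets cardinality fsbigop.

Set Implicit Arguments.
Unset Strict Implicit.
Unset Printing Implicit Defensive.

Import Order.TTheory GRing.Theory Num.Theory.

Local Open Scope classical_set_scope.
Local Open Scope ring_scope.

(* Q[x | x in I]; I is a countType, so it may be finite (even empty) or
   countably infinite. *)
Definition ratpoly (I : countType) := {malg rat[{cmonom I}]}.

HB.instance Definition _ (I : countType) := GRing.ComNzRing.on (ratpoly I).

(* ratpoly I is an integral domain: the monomial m is given the weight
   \sum_i m_i N ^ (pickle i), which is additive in m and, for a suitable N,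
   injective on a given finite set of monomials. *)
Definition monom_poly (I : countType) (m : {cmonom I}) : {poly int} :=
  \sum_(i <- finsupp m) (m i)%:R *: 'X^(choice.pickle i).

Lemma monom_polyw (I : countType) (m : {cmonom I}) (d : {fset I}) :
  (finsupp m `<=` d)%fset ->
  monom_poly m = \sum_(i <- d) (m i)%:R *: 'X^(choice.pickle i).
Proof.
move=> le; rewrite /monom_poly (big_fset_incl _ le) // => i _.
by rewrite -cmE_eq0 => /eqP ->; rewrite scale0r.
Qed.

Lemma monom_polyM (I : countType) (m1 m2 : {cmonom I}) :
  monom_poly (mmul m1 m2) = monom_poly m1 + monom_poly m2.
Proof.
rewrite (@monom_polyw _ (mmul m1 m2) (finsupp m1 `|` finsupp m2)%fset); last first.
  by rewrite mdomD.
rewrite (monom_polyw (fsubsetUl _ (finsupp m2))).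
rewrite (monom_polyw (fsubsetUr (finsupp m1) _)) -big_split /=.
by apply: eq_bigr => i _; rewrite cmM natrD scalerDl.
Qed.

Lemma coef_monom_poly (I : countType) (m : {cmonom I}) (i : I) :
  (monom_poly m)`_(choice.pickle i) = (m i)%:R.
Proof.
rewrite (@monom_polyw _ m (i |` finsupp m)%fset) ?fsubsetUr // coef_sum.
rewrite (big_fsetD1 i) ?fset1U1 //= coefZ coefXn eqxx mulr1 big_seq big1 ?addr0 //.
move=> j; rewrite in_fsetD1 => /andP[ji _]; rewrite coefZ coefXn.
by rewrite (inj_eq (pcan_inj (@choice.pickleK I))) eq_sym (negPf ji) mulr0.
Qed.

Lemma monom_poly_inj (I : countType) : injective (@monom_poly I).
Proof.
move=> m1 m2 e; apply/eqP/cmP => i; apply/eqP.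
by rewrite -(eqr_nat int) -!coef_monom_poly e.
Qed.

Lemma monom_weight (I : countType) (s : seq {cmonom I}) :
  exists w : {cmonom I} -> int,
    (forall m1 m2, w (mmul m1 m2) = w m1 + w m2) /\ {in s &, injective w}.
Proof.
pose P := \prod_(p <- [seq (m1, m2) | m1 <- s, m2 <- s] | p.1 != p.2)
            (monom_poly p.1 - monom_poly p.2).
have P0 : P != 0.
  rewrite prodf_seq_neq0; apply/allP => -[m1 m2] _; apply/implyP => /= ne.
  by rewrite subr_eq0 (inj_eq (@monom_poly_inj I)).
have [N NP] : exists N : int, ~~ root P N.
  apply: contrapT => h.
  pose rs : seq int := [seq n%:Z | n <- iota 0 (size P)].
  have/(max_poly_roots P0) : all (root P) rs.
    by apply/allP => z _; apply: contrapT => /negP nz; apply: h; exists z.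
  rewrite map_inj_uniq ?iota_uniq; last by move=> ? ? [].
  by rewrite size_map size_iota ltnn => /(_ isT).
exists (fun m => (monom_poly m).[N]); split.
  by move=> m1 m2; rewrite monom_polyM hornerD.
move=> m1 m2 m1s m2s e; apply: contrapT => /eqP ne; move/negP: NP; apply.
rewrite /P rootE horner_prod prodf_seq_eq0; apply/hasP; exists (m1, m2).
  by apply/allpairsP; exists (m1, m2).
by rewrite /= ne hornerD hornerN e subrr.
Qed.

Lemma ratpoly_lead (I : countType) (w : {cmonom I} -> int) (p : ratpoly I) :
  p != 0 -> exists2 m, m \in msupp p &
              forall m', m' \in msupp p -> w m' <= w m.
Proof.
rewrite -msupp_eq0 => /fset0Pn[m0 m0p].
case: (@Order.TotalTheory.arg_maxP _ _ (msupp p) [` m0p]%fset predT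
  (fun m => w (val m)) isT) => m _ hm.
by exists (val m); [exact: valP | move=> m' m'p; exact: (hm [` m'p]%fset)].
Qed.

Lemma ratpoly_mulf_eq0 (I : countType) (p q : ratpoly I) :
  p * q = 0 -> (p == 0) || (q == 0).
Proof.
move=> pq0; apply/negPn/negP; rewrite negb_or => /andP[p0 q0].
have [w [wM w_inj]] := monom_weight (msupp p ++ msupp q).
have [m mp hm] := ratpoly_lead w p0.
have [n nq hn] := ratpoly_lead w q0.
have key m' n' : m' \in msupp p -> n' \in msupp q ->
    (mmul m' n' == mmul m n) = (m' == m) && (n' == n).
  move=> m'p n'q; apply/eqP/andP => [e|[/eqP-> /eqP->]//].
  have := congr1 w e; rewrite !wM => ew.
  have wn : w n' = w n.
    apply/eqP; rewrite eq_le hn //= -(lerD2l (w m)) -ew lerD2r; exact: hm.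
  have wm : w m' = w m by move: ew; rewrite wn => /addIr.
  by split; apply/eqP/w_inj; rewrite ?mem_cat ?m'p ?mp ?n'q ?nq ?orbT.
have := congr1 (mcoeff (mmul m n)) pq0.
rewrite mcoeff0 mcoeffMl (big_fsetD1 m) //= (big_fsetD1 n) //= eqxx mulr1n.
rewrite [X in _ + X + _]big1_seq; last first.
  move=> n' /andP[_]; rewrite in_fsetD1 => /andP[ne n'q].
  by rewrite key // (negPf ne) andbF mulr0n.
rewrite [X in _ + X]big1_seq; last first.
  move=> m' /andP[_]; rewrite in_fsetD1 => /andP[ne m'p].
  by apply: big1_seq => n' /andP[_ n'q]; rewrite key // (negPf ne) mulr0n.
rewrite !addr0.
by move/eqP; rewrite mulf_eq0 !mcoeff_eq0 mp nq.
Qed.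

Definition ratpoly_unit (I : countType) : {pred ratpoly I} :=
  fun p => `[< exists q : ratpoly I, q * p = 1 >].

Definition ratpoly_inv (I : countType) (p : ratpoly I) : ratpoly I :=
  if pselect (exists q : ratpoly I, q * p = 1) is left e
  then projT1 (cid e) else p.

Lemma ratpoly_mulVx (I : countType) :
  {in @ratpoly_unit I, left_inverse 1 (@ratpoly_inv I) *%R}.
Proof.
move=> p /asboolP e; rewrite /ratpoly_inv; case: pselect => // e'.
by case: cid.
Qed.

Lemma ratpoly_unitPl (I : countType) (p q : ratpoly I) :
  q * p = 1 -> ratpoly_unit p.
Proof. by move=> e; apply/asboolP; exists q. Qed.

Lemma ratpoly_invr_out (I : countType) :
  {in [predC @ratpoly_unit I], @ratpoly_inv I =1 id}.
Proof.
move=> p; rewrite inE => np; rewrite /ratpoly_inv; case: pselect => // e.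
by case/negP: np; apply/asboolP.
Qed.

HB.instance Definition _ (I : countType) :=
  GRing.ComNzRing_hasMulInverse.Build (ratpoly I)
    (@ratpoly_mulVx I) (@ratpoly_unitPl I) (@ratpoly_invr_out I).

HB.instance Definition _ (I : countType) :=
  GRing.ComUnitRing_isIntegral.Build (ratpoly I) (@ratpoly_mulf_eq0 I).

(* Q(x | x in I) *)
Definition ratfun (I : countType) := {fraction (ratpoly I)}.

HB.instance Definition _ (I : countType) := GRing.Field.on (ratfun I).

Definition indet (I : countType) (i : I) : ratfun I :=
  tofrac (<< ucm i >> : ratpoly I).

(* The cluster of a seed is the set of indeterminates indexed by [lab]. *)
Record seed := Seed {
  lab : countType;
  exch : set lab;
  mat : lab -> lab -> int;
  mat_row_finite : forall x, finite_set [set y | mat x y != 0];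
  mat_col_finite : forall y, finite_set [set x | mat x y != 0];
  mat_skew_symmetrisable : exists d : lab -> int,
    (forall x, 0 < d x) /\ (forall x y, d x * mat x y = - (d y * mat y x)) }.

Definition ambient (Sigma : seed) := ratfun (lab Sigma).

HB.instance Definition _ (Sigma : seed) := GRing.Field.on (ambient Sigma).

(* The seeds mutation-equivalent to [Sigma] are families of elements of
   [ambient Sigma] carrying the labels of [Sigma]; the label of a variable is
   preserved by mutation, so that [var S i] is the variable of [S]
   corresponding to the indeterminate [i] of [Sigma]. *)
Record mutseed (Sigma : seed) := MutSeed {
  var : lab Sigma -> ambient Sigma;
  mexch : set (lab Sigma);
  mmat : lab Sigma -> lab Sigma -> int }.

Definition init (Sigma : seed) : mutseed Sigma :=
  MutSeed (@indet (lab Sigma)) (@exch Sigma) (@mat Sigma).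

(* The two monomials are products over possibly infinite index sets, of which
   all but finitely many factors are 1 since rows of B have finite support. *)
Definition exchange_binomial (Sigma : seed) (S : mutseed Sigma)
    (x : lab Sigma) : ambient Sigma :=
  \big[*%R/1]_(y \in [set y | 0 < mmat S x y]) (var S y ^+ `|mmat S x y|%N) +
  \big[*%R/1]_(y \in [set y | mmat S x y < 0]) (var S y ^+ `|mmat S x y|%N).

Definition mutate (Sigma : seed) (x : lab Sigma) (S : mutseed Sigma) :
    mutseed Sigma :=
  MutSeed
    (fun y => if y == x then exchange_binomial S x / var S x else var S y)
    (mexch S)
    (fun y z =>
       if (x == y) || (x == z) then - mmat S y z
       else mmat S y z + ((`|mmat S y x| * mmat S x z
                           + mmat S y x * `|mmat S x z|) %/ 2)%Z).

(* [mutates S s S']: the sequence of variables [s] is admissible for [S], and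
   mutating [S] along it yields [S'].  The entries of [s] are
   elements of the ambient field: the n-th one (counting from 0) is an exchangeable variable of
   the seed obtained after n mutations. *)
Inductive mutates (Sigma : seed) (S : mutseed Sigma) :
    seq (ambient Sigma) -> mutseed Sigma -> Prop :=
| mutates_nil : mutates S [::] S
| mutates_cons x s S' :
    mexch S x -> mutates (mutate x S) s S' -> mutates S (var S x :: s) S'.

Definition cluster_algebra_pred (Sigma : seed) : {pred ambient Sigma} :=
  fun z => `[< forall P : {pred ambient Sigma}, subring_closed P ->
    (forall s S, mutates (init Sigma) s S -> forall i, var S i \in P) ->
    z \in P >].

Lemma cluster_algebra_subring (Sigma : seed) :
  subring_closed (@cluster_algebra_pred Sigma).
Proof.
split.
- by apply/asboolP => P [].
- move=> a b /asboolP ha /asboolP hb; apply/asboolP => P hP hv.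
  by case: (hP) => _ hB _; apply: hB; [exact: ha | exact: hb].
- move=> a b /asboolP ha /asboolP hb; apply/asboolP => P hP hv.
  by case: (hP) => _ _ hM; apply: hM; [exact: ha | exact: hb].
Qed.

HB.instance Definition _ (Sigma : seed) :=
  GRing.isSubringClosed.Build (ambient Sigma) (@cluster_algebra_pred Sigma)
    (@cluster_algebra_subring Sigma).

Record cluster_algebra (Sigma : seed) := ClusterAlgebra {
  clval : ambient Sigma;
  _ : clval \in @cluster_algebra_pred Sigma }.

HB.instance Definition _ (Sigma : seed) := [isSub for @clval Sigma].
HB.instance Definition _ (Sigma : seed) :=
  [Choice of cluster_algebra Sigma by <:].
HB.instance Definition _ (Sigma : seed) :=
  [SubChoice_isSubComNzRing of cluster_algebra Sigma by <:].

Lemma var_cluster_algebra (Sigma : seed) s (S : mutseed Sigma) :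
  mutates (init Sigma) s S -> forall i, var S i \in @cluster_algebra_pred Sigma.
Proof. by move=> hS i; apply/asboolP => P _; apply; exact: hS. Qed.

Definition clvar (Sigma : seed) s (S : mutseed Sigma)
    (hS : mutates (init Sigma) s S) (i : lab Sigma) : cluster_algebra Sigma :=
  ClusterAlgebra (var_cluster_algebra hS i).

Definition initvar (Sigma : seed) (i : lab Sigma) : cluster_algebra Sigma :=
  clvar (mutates_nil (init Sigma)) i.

(* Graph of the iterated mutation x |-> mu_{s_n} o ... o mu_{s_1} (x) on the
   disjoint union of the initial cluster and Z. *)
Variant mutated (Sigma : seed) s (S : mutseed Sigma)
    (hS : mutates (init Sigma) s S) :
    cluster_algebra Sigma -> cluster_algebra Sigma -> Prop :=
| mutated_var i : mutated hS (initvar i) (clvar hS i)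
| mutated_int (m : int) : mutated hS m%:~R m%:~R.

(* In CM3, the hypotheses [hS] and [hS'] together say that [s] is
   (f, Sigma, Sigma')-biadmissible. *)
Record rooted_cluster_morphism (Sigma Sigma' : seed) := RootedClusterMorphism {
  rcm_fun :> {rmorphism cluster_algebra Sigma -> cluster_algebra Sigma'};
  rcm_CM1 : forall i : lab Sigma,
    (exists j : lab Sigma', rcm_fun (initvar i) = initvar j) \/
    (exists m : int, rcm_fun (initvar i) = m%:~R);
  rcm_CM2 : forall i : lab Sigma, exch i ->
    (exists2 j : lab Sigma', exch j & rcm_fun (initvar i) = initvar j) \/
    (exists m : int, rcm_fun (initvar i) = m%:~R);
  rcm_CM3 : forall (s : seq (cluster_algebra Sigma))
      (S : mutseed Sigma) (S' : mutseed Sigma')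
      (hS : mutates (init Sigma) [seq clval a | a <- s] S)
      (hS' : mutates (init Sigma') [seq clval (rcm_fun a) | a <- s] S')
      (i : lab Sigma),
    mutated hS' (rcm_fun (initvar i)) (rcm_fun (clvar hS i)) }.

(* Composition and equality in Clus are those of the underlying maps. *)
Definition Clus_monomorphism (Sigma Sigma' : seed)
    (f : rooted_cluster_morphism Sigma Sigma') : Prop :=
  forall (Sigma0 : seed) (g h : rooted_cluster_morphism Sigma0 Sigma),
    f \o g =1 f \o h -> g =1 h.

(* Main.v *)
(** Let P be the seed with a single variable z, which is frozen, so that
    A(P) = Z[z] and every element of x U Z is the image of z under a rooted
    cluster morphism A(P) -> A(Sigma).  A monomorphism f is therefore injective
    on x U Z, hence it maps the cluster x injectively into the cluster x' (a
    variable sent to an integer m would have the same image as m).  The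
    variables in x' being algebraically independent, f is injective on Z[x];
    clearing denominators, it is injective on A(Sigma), which is a domain
    inside Q(x). *)

From HB Require Import structures.
Require Import Defs.
From mathcomp Require Import all_boot all_algebra.
From mathcomp Require Import finmap monalg boolp classical_sets cardinality.

Set Implicit Arguments.
Unset Strict Implicit.
Unset Printing Implicit Defensive.

Import GRing.Theory Num.Theory.

Local Open Scope classical_set_scope.
Local Open Scope ring_scope.

(** * Renaming of indeterminates in monomials and polynomials *)

Definition cm_exp (I : choiceType) (m : {cmonom I}) (n : nat) : {cmonom I} :=
  iter n (mmul m) mone.

Lemma cm_expE (I : choiceType) (m : {cmonom I}) n i :
  cm_exp m n i = (n * m i)%N.
Proof. by elim: n => [|n IHn]; rewrite ?cm1 // /cm_exp iterS cmM IHn. Qed.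

Definition cm_map (I J : choiceType) (g : I -> J) (m : {cmonom I}) :
    {cmonom J} :=
  \big[mmul/mone]_(i <- finsupp m) cm_exp (ucm (g i)) (m i).

Lemma cm_mapE (I J : choiceType) (g : I -> J) (m : {cmonom I}) i :
  injective g -> cm_map g m (g i) = m i.
Proof.
move=> g_inj; rewrite /cm_map.
have cmD :
    {morph (fun k : {cmonom J} => k (g i)) : a b / mmul a b >-> (a + b)%N}.
  by move=> a b; rewrite cmM.
rewrite (big_morph _ cmD (cm1 (g i))).
rewrite (eq_bigr (fun j => m j * (j == i))%N); last first.
  by move=> j _; rewrite cm_expE cmU (inj_eq g_inj).
case: (mdomP m i) => mi.
  rewrite (big_fsetD1 i) //= eqxx muln1 big1_seq ?addn0 // => j.
  by rewrite in_fsetD1 => /andP[_ /andP[/negPf-> _]]; rewrite muln0.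
rewrite big1_seq // => j /andP[_ jm].
by case: eqP jm mi => [->->|] //; rewrite muln0.
Qed.

Lemma cm_map_inj (I J : choiceType) (g : I -> J) :
  injective g -> injective (cm_map g).
Proof.
by move=> g_inj m n e; apply/eqP/cmP => i; rewrite -!(cm_mapE _ _ g_inj) e.
Qed.

Lemma cm_map_id (I : choiceType) (m : {cmonom I}) : cm_map id m = m.
Proof. by apply/eqP/cmP => i; exact: (@cm_mapE _ _ id). Qed.

Lemma monalgUM (I : countType) (m n : {cmonom I}) :
  << mmul m n >> = << m >> * << n >> :> ratpoly I.
Proof. by rewrite [RHS]malgM_def fgmulUU mulr1. Qed.

Lemma monalgU_exp (I : countType) (m : {cmonom I}) n :
  << cm_exp m n >> = << m >> ^+ n :> ratpoly I.
Proof. by elim: n => [//|n IHn]; rewrite exprS -IHn -monalgUM. Qed.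

Lemma monalgU_map (I J : countType) (g : I -> J) (m : {cmonom I}) :
  << cm_map g m >> = \prod_(i <- finsupp m) << ucm (g i) >> ^+ m i :> ratpoly J.
Proof.
rewrite /cm_map (big_morph (fun k => << k >> : ratpoly J) (@monalgUM J) erefl).
by apply: eq_bigr => i _; rewrite monalgU_exp.
Qed.

Lemma ratpoly_ind (I : countType) (P : ratpoly I -> Prop) :
  P 0 -> (forall p q, P p -> P q -> P (p + q)) ->
  (forall c m, P << c *g m >>) -> forall p, P p.
Proof.
by move=> P0 PD PU p; rewrite [p]monalgE; apply: (@big_ind _ P).
Qed.

(** The substitution of x_(g i) for x_i, with rational coefficients embedded as constant
    polynomials. *)
Definition ratpoly_map (I J : countType) (g : I -> J) (p : ratpoly I) :
    ratpoly J :=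
  mmap (mkmalgU mone) (fun m => << cm_map g m >>) p.

Lemma ratpoly_mapB (I J : countType) (g : I -> J) :
  {morph ratpoly_map g : p q / p - q}.
Proof. exact: mmapB. Qed.

HB.instance Definition _ (I J : countType) (g : I -> J) :=
  GRing.isZmodMorphism.Build (ratpoly I) (ratpoly J) (ratpoly_map g)
    (@ratpoly_mapB I J g).

Lemma ratpoly_mapU (I J : countType) (g : I -> J) m :
  ratpoly_map g << m >> = << cm_map g m >>.
Proof. by rewrite /ratpoly_map mmapU; exact: mul1r. Qed.

(** Since [cm_map g] is injective, [m] is the only monomial of [p] that can contribute to this
    coefficient. *)
Lemma mcoeff_ratpoly_map (I J : countType) (g : I -> J) (p : ratpoly I) m :
  injective g -> (ratpoly_map g p)@_(cm_map g m) = p@_m.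
Proof.
move=> /cm_map_inj g_inj; rewrite /ratpoly_map /mmap raddf_sum /=.
rewrite (eq_bigr (fun k => p@_k *+ (k == m))); last first.
  move=> k _; rewrite mul_malgC mcoeffZ mcoeffU1 (inj_eq g_inj).
  by rewrite mulr_natr.
case: msuppP => mp.
  rewrite (big_fsetD1 m) //= eqxx big1_seq ?addr0 // => k.
  by rewrite in_fsetD1 => /andP[_ /andP[/negPf-> _]].
rewrite big1_seq // => k /andP[_ kp].
by case: eqP kp mp => [->->|].
Qed.

Lemma ratpoly_map_eq0 (I J : countType) (g : I -> J) (p : ratpoly I) :
  injective g -> ratpoly_map g p = 0 -> p = 0.
Proof.
move=> g_inj e; apply/malgP => m.
by rewrite -(mcoeff_ratpoly_map p m g_inj) e !mcoeff0.
Qed.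

Lemma ratpoly_mulrn_eq0 (I : countType) (p : ratpoly I) n :
  n != 0%N -> p *+ n = 0 -> p = 0.
Proof.
move=> n0 e; apply/malgP => m; rewrite mcoeff0; apply/eqP.
have /eqP := congr1 (mcoeff m) e.
by rewrite mcoeffMn mcoeff0 mulrn_eq0 (negPf n0).
Qed.

(** * Clearing denominators *)

Lemma fractionP (R : idomainType) (z : {fraction R}) :
  exists p q : R, q != 0 /\ z * tofrac q = tofrac p.
Proof.
elim/quotW: z => x; exists \n_x, \d_x.
split; first exact: denom_ratioP.
unlock FracField.tofrac.
rewrite -[LHS]FracField.pi_mul; apply/eqmodP; rewrite /= FracField.equivfE.
by rewrite !numden_Ratio ?mulr1 ?oner_neq0 ?denom_ratioP // mulrC.
Qed.

Lemma clval_is_zmod_morphism (Sigma : seed) : zmod_morphism (@clval Sigma).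
Proof. by []. Qed.

Lemma clval_is_monoid_morphism (Sigma : seed) : monoid_morphism (@clval Sigma).
Proof. by []. Qed.

HB.instance Definition _ (Sigma : seed) :=
  GRing.isZmodMorphism.Build (cluster_algebra Sigma) (ambient Sigma)
    (@clval Sigma) (@clval_is_zmod_morphism Sigma).

HB.instance Definition _ (Sigma : seed) :=
  GRing.isMonoidMorphism.Build (cluster_algebra Sigma) (ambient Sigma)
    (@clval Sigma) (@clval_is_monoid_morphism Sigma).

Lemma clval_inj (Sigma : seed) : injective (@clval Sigma).
Proof. exact: val_inj. Qed.

(** [A] need not contain the rationals, so [p] itself may not come from [A]; but for a common
    denominator [n] of its coefficients, [p *+ n] has integer coefficients, and [a] is its value at
    the [x i]. The same [a] serves [v] and [u]. *)
Lemma clear_denominators (I J : countType) (g : I -> J)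
    (A F F' : comNzRingType) (v : {rmorphism A -> F}) (u : {rmorphism A -> F'})
    (t : {rmorphism ratpoly I -> F}) (s : {rmorphism ratpoly J -> F'})
    (x : I -> A) :
  (forall i, v (x i) = t << ucm i >>) ->
  (forall i, u (x i) = s << ucm (g i) >>) ->
  forall p : ratpoly I, exists n (a : A),
    [/\ n != 0%N, v a = t (p *+ n) & u a = s (ratpoly_map g (p *+ n))].
Proof.
move=> vx ux; elim/ratpoly_ind => [|p1 p2|c m].
- by exists 1%N, 0; rewrite !raddf0.
- move=> [n1 [a1 [n10 v1 u1]]] [n2 [a2 [n20 v2 u2]]].
  (* Addition of fractions with denominators [n1] and [n2]. *)
  exists (n1 * n2)%N, (a1 *+ n2 + a2 *+ n1).
  have -> : (p1 + p2) *+ (n1 * n2) = p1 *+ n1 *+ n2 + p2 *+ n2 *+ n1.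
    by rewrite mulrnDl mulrnA; congr (_ + _); rewrite mulnC mulrnA.
  split; first by rewrite muln_eq0 (negPf n10) (negPf n20).
    by rewrite (rmorphD v) (rmorphD t) 2!(rmorphMn v) v1 v2 -2!(rmorphMn t).
  rewrite (rmorphD u) 2!(rmorphMn u) u1 u2 (raddfD (ratpoly_map g)) (rmorphD s).
  by rewrite !(raddfMn (ratpoly_map g)) !(rmorphMn s).
- exists `|denq c|%N, ((\prod_(i <- finsupp m) x i ^+ m i) *~ numq c).
  have -> : << c *g m >> *+ `|denq c|%N = << m >> *~ numq c :> ratpoly I.
    rewrite -[LHS]monalgUMn -[RHS](raddfMz (mkmalgU m)); congr mkmalgU.
    rewrite pmulrn absz_denq -mulrzr -{1}[c]divq_num_den.
    by rewrite divfK ?intr_eq0 ?denq_neq0.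
  split; first by rewrite absz_eq0 denq_neq0.
    (* Viewing [m] as renamed along the identity splits it into powers of indeterminates. *)
    rewrite (rmorphMz v) (rmorphMz t) -[m in RHS]cm_map_id monalgU_map.
    rewrite !rmorph_prod.
    by congr (_ *~ _); apply: eq_bigr => i _; rewrite !rmorphXn vx.
  rewrite (rmorphMz u) (raddfMz (ratpoly_map g)) /= (rmorphMz s).
  rewrite ratpoly_mapU monalgU_map !rmorph_prod.
  by congr (_ *~ _); apply: eq_bigr => i _; rewrite !rmorphXn ux.
Qed.

(** Let [u a = 0] and write [v a] as p/q. Multiples of [q] and [p] come from elements [b] and [c] of
    [A], and a b equals c up to positive integer factors, by injectivity of [v]. Applying [u] kills
    a multiple of the renamed [p]; renaming along an injective [g] loses nothing, so p = 0 and a =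
    0. *)
Lemma injective_of_injective_on_indet (I J : countType) (g : I -> J)
    (A : comNzRingType) (v : {rmorphism A -> ratfun I})
    (u : {rmorphism A -> ratfun J}) (x : I -> A) :
  (forall i, v (x i) = indet i) -> (forall i, u (x i) = indet (g i)) ->
  injective v -> injective g -> injective u.
Proof.
move=> vx ux v_inj g_inj; apply: raddf_inj => a ua0.
have [p [q [q0 apq]]] := fractionP (v a).
have [n1 [b [n10 /= vb _]]] := clear_denominators vx ux q.
have [n2 [c [n20 /= vc uc]]] := clear_denominators vx ux p.
have abc : a * b *+ n2 = c *+ n1.
  apply: v_inj; rewrite 2!(rmorphMn v) (rmorphM v) vb vc 2!tofracMn.
  by rewrite mulrnAr apq mulrnAC.
have p0 : p = 0.
  apply: (ratpoly_mulrn_eq0 n20); apply: (ratpoly_mulrn_eq0 n10).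
  apply: (ratpoly_map_eq0 g_inj).
  rewrite (raddfMn (ratpoly_map g)); apply/eqP.
  by rewrite -tofrac_eq0 tofracMn -uc -(rmorphMn u) -abc (rmorphMn u)
    (rmorphM u) ua0 mul0r mul0rn.
apply: v_inj; apply/eqP; rewrite (rmorph0 v).
by move/eqP: apq; rewrite p0 tofrac0 mulf_eq0 tofrac_eq0 (negPf q0) orbF.
Qed.

(** * Transcendence and distinctness of the initial variables *)

Lemma rmorph_horner_int (A B : comNzRingType) (phi : {rmorphism A -> B})
    (p : {poly int}) x :
  phi (map_poly intr p).[x] = (map_poly intr p).[phi x].
Proof.
rewrite -horner_map -map_poly_comp; congr (_.[_]).
by apply: eq_map_poly => m /=; rewrite rmorph_int.
Qed.

Lemma cm_exp_ucm_inj (I : choiceType) (i : I) : injective (cm_exp (ucm i)).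
Proof.
move=> m n /(congr1 (fun k : {cmonom I} => k i)).
by rewrite !cm_expE cmUU !muln1.
Qed.

Lemma mcoeff_horner_ucm (I : countType) (i : I) (p : {poly int}) n :
  (map_poly intr p).[<< ucm i >> : ratpoly I]@_(cm_exp (ucm i) n) = (p`_n)%:~R.
Proof.
rewrite (@horner_coef_wide _ (size p)) ?size_poly // raddf_sum /=.
rewrite (eq_bigr (fun k : 'I_(size p) => (p`_k)%:~R *+ (k == n :> nat))).
  have [n_p | p_n] := ltnP n (size p).
    rewrite (bigD1 (Ordinal n_p)) //= eqxx big1 ?addr0 // => k.
    by rewrite -val_eqE /= => /negPf->.
  rewrite (nth_default _ p_n) big1 // => k _.
  by rewrite ltn_eqF // (leq_trans (ltn_ord k)).
move=> k _; rewrite coef_map /= mulrzl raddfMz -monalgU_exp /= mcoeffU1.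
by rewrite (inj_eq (@cm_exp_ucm_inj _ i)) -mulrzl mulr_natr.
Qed.

(** The relation already holds in the polynomial ring, which embeds in its fraction field; there the
    coefficients of [p] are read off at the powers of the indeterminate. *)
Lemma initvar_transcendental (Sigma : seed) (i : lab Sigma) (p : {poly int}) :
  (map_poly intr p).[initvar i] = 0 -> p = 0.
Proof.
move=> e0.
have : tofrac (map_poly intr p).[<< ucm i >> : ratpoly (lab Sigma)] = 0.
  rewrite (rmorph_horner_int (@tofrac (ratpoly _))).
  rewrite -(rmorph0 (@clval Sigma)) -e0.
  by rewrite (rmorph_horner_int (@clval Sigma)).
move/eqP; rewrite tofrac_eq0 => /eqP e.
apply/polyP => n; apply/eqP; rewrite coef0 -(intr_eq0 rat).
by rewrite -(mcoeff_horner_ucm i) e mcoeff0.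
Qed.

Lemma indet_inj (I : countType) : injective (@indet I).
Proof.
move=> i j /eqP; rewrite tofrac_eq => /eqP ij.
have : (<< ucm i >> : ratpoly I)@_(ucm j) = 1 by rewrite ij mcoeffUU.
rewrite mcoeffU; case: (ucm i =P ucm j) => [|_ /eqP]; last first.
  by rewrite eq_sym oner_eq0.
move=> /(congr1 (fun k : {cmonom _} => k i)).
by rewrite !cmU eqxx; case: (j =P i).
Qed.

Lemma initvar_inj (Sigma : seed) : injective (@initvar Sigma).
Proof. by move=> i j /(congr1 (@clval Sigma)) /indet_inj. Qed.

Lemma initvar_neq_int (Sigma : seed) (i : lab Sigma) (m : int) :
  initvar i <> m%:~R.
Proof.
(* The variable would be a root of the nonzero polynomial X - m. *)
move=> e; have /eqP : 'X - m%:P = 0 :> {poly int}.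
  apply: (@initvar_transcendental _ i).
  by rewrite rmorphB /= map_polyX map_polyC hornerXsubC e subrr.
by rewrite polyXsubC_eq0.
Qed.

(** * The seed with one frozen variable and the morphisms out of its algebra *)

Lemma point_mat_finite (x : unit) :
  finite_set [set y : unit | (0 : int) != 0].
Proof. exact: finite_finset. Qed.

Lemma point_skew_symmetrisable : exists d : unit -> int,
  (forall x, 0 < d x) /\ (forall x y, d x * 0 = - (d y * 0)).
Proof. by exists (fun=> 1); split=> // x y; rewrite mulr0 oppr0. Qed.

Definition point_seed : seed :=
  @Seed unit set0 (fun _ _ => 0) point_mat_finite point_mat_finite
    point_skew_symmetrisable.

Lemma point_mutates s S : mutates (init point_seed) s S ->
  s = [::] /\ S = init point_seed.
Proof. by case. Qed.

Definition point_var : cluster_algebra point_seed :=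
  @initvar point_seed tt.

(** The values p(z) form a subring containing the only cluster variable z, and the cluster algebra
    is the least such subring. *)
Lemma point_poly (a : cluster_algebra point_seed) :
  exists p : {poly int}, a = (map_poly intr p).[point_var].
Proof.
suff: exists p : {poly int}, clval a = clval (map_poly intr p).[point_var].
  by move=> [p /clval_inj ap]; exists p.
case: a => z /= /asboolP/(_ (fun z => `[< exists p : {poly int},
  z = clval (map_poly intr p).[point_var] >])) h.
apply/asboolP; apply: h => [|s S /point_mutates[_ ->] []].
  split.
  - by apply/asboolP; exists 1; rewrite rmorph1 hornerC.
  - move=> x y /asboolP[p ->] /asboolP[q ->]; apply/asboolP; exists (p - q).
    by rewrite !rmorphB hornerD hornerN /=.
  - move=> x y /asboolP[p ->] /asboolP[q ->]; apply/asboolP; exists (p * q).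
    by rewrite !rmorphM hornerM.
by apply/asboolP; exists 'X; rewrite map_polyX hornerX.
Qed.

Definition point_poly_of (a : cluster_algebra point_seed) : {poly int} :=
  projT1 (cid (point_poly a)).

Lemma point_poly_ofK a : (map_poly intr (point_poly_of a)).[point_var] = a.
Proof. by rewrite /point_poly_of; case: cid. Qed.

Lemma point_poly_of_horner p :
  point_poly_of (map_poly intr p).[point_var] = p.
Proof.
apply/eqP; rewrite -subr_eq0; apply/eqP.
apply: (@initvar_transcendental point_seed tt).
by rewrite rmorphB hornerD hornerN point_poly_ofK subrr.
Qed.

(** The ring morphism from Z[z] to [A] given by the universal property; it is well behaved because z
    is transcendental, so that the chosen polynomial is unique. *)
Definition point_map (A : comNzRingType) (x : A)
    (a : cluster_algebra point_seed) : A :=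
  (map_poly intr (point_poly_of a)).[x].

Lemma point_map_horner (A : comNzRingType) (x : A) p :
  point_map x (map_poly intr p).[point_var] = (map_poly intr p).[x].
Proof. by rewrite /point_map point_poly_of_horner. Qed.

Lemma point_map_is_zmod_morphism (A : comNzRingType) (x : A) :
  zmod_morphism (point_map x).
Proof.
move=> a b; rewrite -[a]point_poly_ofK -[b]point_poly_ofK -hornerN -hornerD.
by rewrite -rmorphB !point_map_horner rmorphB hornerD hornerN.
Qed.

Lemma point_map_is_monoid_morphism (A : comNzRingType) (x : A) :
  monoid_morphism (point_map x).
Proof.
split=> [|a b].
  have {1}-> : 1 = (map_poly intr 1).[point_var] by rewrite rmorph1 hornerC.
  by rewrite point_map_horner rmorph1 hornerC.
rewrite -[a]point_poly_ofK -[b]point_poly_ofK -hornerM.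
by rewrite -rmorphM !point_map_horner rmorphM hornerM.
Qed.

HB.instance Definition _ (A : comNzRingType) (x : A) :=
  GRing.isZmodMorphism.Build (cluster_algebra point_seed) A (point_map x)
    (point_map_is_zmod_morphism x).

HB.instance Definition _ (A : comNzRingType) (x : A) :=
  GRing.isMonoidMorphism.Build (cluster_algebra point_seed) A (point_map x)
    (point_map_is_monoid_morphism x).

Lemma point_map_var (A : comNzRingType) (x : A) : point_map x point_var = x.
Proof.
have -> : point_var = (map_poly intr 'X).[point_var].
  by rewrite map_polyX hornerX.
by rewrite point_map_horner map_polyX hornerX.
Qed.

(** The hypothesis on [x] is CM1. With no exchangeable variable, CM2 is vacuous and CM3 concerns
    only the empty sequence. *)
Lemma point_morphism (Sigma : seed) (x : cluster_algebra Sigma) :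
  (exists j, x = initvar j) \/ (exists m : int, x = m%:~R) ->
  exists g : rooted_cluster_morphism point_seed Sigma, g =1 point_map x.
Proof.
move=> hx.
have CM1 (i : lab point_seed) :
    (exists j, point_map x (initvar i) = initvar j) \/
    (exists m : int, point_map x (initvar i) = m%:~R).
  by case: i; rewrite point_map_var.
have CM3 (s : seq (cluster_algebra point_seed)) (S : mutseed point_seed)
    (S' : mutseed Sigma)
    (hS : mutates (init point_seed) [seq clval a | a <- s] S)
    (hS' : mutates (init Sigma) [seq clval (point_map x a) | a <- s] S')
    (i : lab point_seed) :
    mutated hS' (point_map x (initvar i)) (point_map x (clvar hS i)).
  have [s0 S0] := point_mutates hS; case: s s0 hS hS' => // _ hS hS'.
  have S0' : S' = init Sigma.
    by move: hS'; rewrite /=; move e: [::] => s0 h; case: h e.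
  have -> : clvar hS i = initvar i by apply: clval_inj; rewrite /= S0.
  case: (CM1 i) => [[j ->]|[m ->]]; last exact: mutated_int.
  (* Only the image side is rewritten, to match the shape of [mutated_var]; no mutation has
     occurred. *)
  rewrite {2}(_ : initvar j = clvar hS' j); first exact: mutated_var.
  by apply: clval_inj; rewrite /= S0'.
by exists (@RootedClusterMorphism point_seed Sigma (point_map x) CM1
  (fun i => False_ind _) CM3).
Qed.

(** * From monomorphisms to injective maps *)

Lemma monomorphism_inj_on_initvar (Sigma Sigma' : seed)
    (f : rooted_cluster_morphism Sigma Sigma') (x y : cluster_algebra Sigma) :
  Clus_monomorphism f ->
  (exists j, x = initvar j) \/ (exists m : int, x = m%:~R) ->
  (exists j, y = initvar j) \/ (exists m : int, y = m%:~R) ->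
  f x = f y -> x = y.
Proof.
move=> f_mono /point_morphism[g gE] /point_morphism[h hE] fxy.
have gh : g =1 h.
  (* With a = p(z), the two composites give p(f x) and p(f y). *)
  apply: f_mono => a; rewrite /= gE hE /point_map.
  by rewrite !(rmorph_horner_int f) fxy.
by rewrite -(point_map_var x) -(point_map_var y) -gE -hE gh.
Qed.

Theorem proposition4p3 (Sigma Sigma' : seed)
    (f : rooted_cluster_morphism Sigma Sigma') :
  Clus_monomorphism f <-> injective f.
Proof.
split=> [f_mono|f_inj Sigma0 g h fgh a]; last exact/f_inj/fgh.
have f_var i : exists j, f (initvar i) = initvar j.
  (* If the variable had image m, it would equal the integer m, which has the same image. *)
  case: (rcm_CM1 f i) => // -[m fi]; case: (@initvar_neq_int _ i m).
  apply: (monomorphism_inj_on_initvar f_mono); first by left; exists i.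
    by right; exists m.
  by rewrite fi rmorph_int.
have [g fg] := choice f_var.
suff: injective (@clval Sigma' \o f) by exact: inj_compr.
apply: (@injective_of_injective_on_indet _ _ g _ (@clval Sigma)
  (@clval Sigma' \o f) (@initvar Sigma)) => [i|i||i j gij] //.
- by rewrite /= fg.
- exact: clval_inj.
(* Injectivity of [g]: if g i = g j, the variables [i] and [j] have the same image under [f]. *)
apply: initvar_inj; apply: (monomorphism_inj_on_initvar f_mono).
- by left; exists i.
- by left; exists j.
- by rewrite !fg gij.
Qed.
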